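(* Let $g:\mathbb{N}_{\ge1}\to\mathbb{N}$ be defined by $g(1) = 0, g(2) = 1, g(3) = 2, g(4) = 4, g(5) = 5$ and, for $n \geq 6$, $$g(n) = n - 1 + \min\{g(n_1) + g(n_2) : n_1, n_2 \text{ positive integers with } n_1 + n_2 = n - 1\}.$$ Then $g(n) = x_n$ for every integer $n \geq 1$.
   Context: The sequence $(x_n)_{n\ge1}$ is defined by $x_1 = 0, x_2 = 1, x_3 = 2, x_4 = 4, x_5 = 5$ and, for $n \geq 6$, $$x_n = (n - 1) + \begin{cases} x_{\frac{n + 1}{2}} + x_{\frac{n - 3}{2}}, & n \equiv 1 \pmod 4,\\ 2 x_{\frac{n - 1}{2}}, & n \equiv 3 \pmod 4,\\ x_{\frac{n}{2}} + x_{\frac{n - 2}{2}}, & n \text{ even}. \end{cases}$$ (In the paper, $g(n)$ is the number of arcs of a recursively constructed oriented graph $\overrightarrow{O}_n$ of weak diameter at most $2$: for $n\ge6$, $\overrightarrow{O}_n$ consists of disjoint copies of $\overrightarrow{O}_{n_1}$ and $\overrightarrow{O}_{n_2}$ with $n_1+n_2=n-1$ chosen to minimize the total arc count, plus a new vertex $v$ with arcs from every vertex of $\overrightarrow{O}_{n_1}$ to $v$ and from $v$ to every vertex of $\overrightarrow{O}_{n_2}$.) *)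

(* Defs.v *)
From mathcomp Require Import all_boot.
From mathcomp Require Import zify.

Set Implicit Arguments.
Unset Strict Implicit.
Unset Printing Implicit Defensive.

Definition is_min (A : nat -> Prop) (m : nat) : Prop :=
  A m /\ forall k, A k -> m <= k.

Definition split_sum (g : nat -> nat) (n s : nat) : Prop :=
  exists n1 n2, [/\ 0 < n1, 0 < n2, n1 + n2 = n - 1 & s = g n1 + g n2].

(* Sequences indexed by n >= 1 are functions on nat whose value at 0 is left
   unconstrained: neither recurrence ever refers to index 0. *)

Definition g_spec (g : nat -> nat) : Prop :=
  [/\ g 1 = 0, g 2 = 1, g 3 = 2, g 4 = 4 & g 5 = 5] /\
  forall n, 6 <= n ->
    exists m, is_min (split_sum g n) m /\ g n = (n - 1) + m.

(* All the natural-number subtractions and divisions by 2 are exact in the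
   branches where they occur. *)
Definition x_spec (x : nat -> nat) : Prop :=
  [/\ x 1 = 0, x 2 = 1, x 3 = 2, x 4 = 4 & x 5 = 5] /\
  forall n, 6 <= n ->
    [/\ n = 1 %[mod 4] ->
          x n = (n - 1) + (x ((n + 1) %/ 2) + x ((n - 3) %/ 2)),
        n = 3 %[mod 4] -> x n = (n - 1) + 2 * x ((n - 1) %/ 2)
      & ~~ odd n -> x n = (n - 1) + (x (n %/ 2) + x ((n - 2) %/ 2))].

(* Each system of equations has a solution, so hypotheses [g_spec g] and
   [x_spec x] are satisfiable; they determine g and x on n >= 1. *)

Lemma course_of_values (F : nat -> (nat -> nat) -> nat) :
  (forall n f f', (forall k, k < n -> f k = f' k) -> F n f = F n f') ->
  exists f, forall n, f n = F n f.
Proof.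
move=> FE; pose T := fix T n :=
  if n is m.+1 then rcons (T m) (F m (nth 0 (T m))) else [::].
have sT n : size (T n) = n by elim: n => //= n IH; rewrite size_rcons IH.
pose f n := F n (nth 0 (T n)).
have TE n k : k < n -> nth 0 (T n) k = f k.
  elim: n => //= n IH; rewrite ltnS nth_rcons sT => le_kn.
  by case: ltngtP le_kn => // [/IH|->].
by exists f => n; apply: FE => k; apply: TE.
Qed.

Lemma ex_is_min (A : nat -> Prop) (s : seq nat) :
  (forall k, A k <-> k \in s) -> 0 < size s -> is_min A (foldr minn (head 0 s) s).
Proof.
move=> AE s_gt0; split; last first.
  move=> k /AE; elim: (s) (head 0 s) => //= a t IH d.
  by rewrite inE => /predU1P[->|/(IH d)]; lia.
apply/AE; case: s s_gt0 {AE} => //= a t _.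
suff: foldr minn a t \in a :: t.
  by rewrite /minn; case: ifP => // _ _; rewrite mem_head.
elim: t => [|b t IH] /=; first exact: mem_head.
rewrite /minn; case: ifP => _; first by rewrite !inE eqxx orbT.
by move: IH; rewrite !inE => /orP[->|->]; rewrite ?orbT.
Qed.

Lemma g_spec_ex : exists g, g_spec g.
Proof.
pose S (f : nat -> nat) n := [seq f i + f (n - 1 - i) | i <- iota 1 (n - 2)].
pose F n f := if n < 6 then nth 0 [:: 0; 0; 1; 2; 4; 5] n
              else (n - 1) + foldr minn (head 0 (S f n)) (S f n).
have [n f f' eq_f|g gE] := @course_of_values F.
  rewrite /F; case: ltnP => // n6.
  suff -> : S f n = S f' n by [].
  apply/eq_in_map => i; rewrite mem_iota => Hi.
  by rewrite !eq_f //; lia.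
exists g; split; first by split; rewrite gE.
move=> n n6; exists (foldr minn (head 0 (S g n)) (S g n)); split; last first.
  by rewrite {1}gE /F ltnNge n6.
apply: ex_is_min => [k|]; last by rewrite size_map size_iota; lia.
split=> [[n1 [n2 [h1 h2 h ->]]]|/mapP[i]].
  by apply/mapP; exists n1; [rewrite mem_iota | congr (_ + g _)]; lia.
rewrite mem_iota => Hi ->; exists i, (n - 1 - i); split=> //; lia.
Qed.

Lemma x_spec_ex : exists x, x_spec x.
Proof.
pose F n (f : nat -> nat) := if n < 6 then nth 0 [:: 0; 0; 1; 2; 4; 5] n
  else (n - 1) + if n %% 4 == 1 then f ((n + 1) %/ 2) + f ((n - 3) %/ 2)
                 else if n %% 4 == 3 then 2 * f ((n - 1) %/ 2)
                 else f (n %/ 2) + f ((n - 2) %/ 2).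
have [n f f' eq_f|x xE] := @course_of_values F.
  by rewrite /F; case: ltnP => // n6; rewrite !eq_f //; lia.
exists x; split; first by split; rewrite xE.
move=> n n6; split=> hn; rewrite {1}xE /F ltnNge n6 /=.
- by rewrite hn.
- by rewrite hn.
- by rewrite !ifN //; apply/eqP; lia.
Qed.

(* Main.v *)
(* Call a pair (p, q) balanced for n if p + q = n - 1, |p - q| <= 2, and p is
   odd when n is odd; these are the splits used by the recurrence for x.
   Minimality of the balanced split is the inequality
   x(a + b + 1) <= a + b + x(a) + x(b).  If (a1, a2) and (b1, b2) are balanced
   for a and b, then, after possibly exchanging b1 and b2, the pair
   (a1 + b1 + 1, a2 + b2 + 1) is balanced for a + b + 1; hence the inequality
   for (a, b) follows from those for (a1, b1) and (a2, b2).  The exceptions are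
   a = 1, 2, settled by a bound on x(n + 1) - x(n), and a = 5, where x(5) is one
   less than the recurrence would give, a loss absorbed by the slack in the
   inequality for (1, b2). *)
Require Import Defs.
From mathcomp Require Import all_boot.
From mathcomp Require Import zify.

Definition balanced (n p q : nat) : Prop :=
  [/\ p + q + 1 = n, p <= q + 2, q <= p + 2 & odd n -> odd p].

Lemma balanced_ex n : 3 <= n -> exists p q, balanced n p q.
Proof.
move=> n3; have [/eqP n1|n1] := boolP (n %% 4 == 1).
  by exists (n %/ 2).+1, (n %/ 2).-1; split; lia.
by exists (n %/ 2), (n - 1 - n %/ 2); split; lia.
Qed.

(** Consecutive indices admit balanced splits sharing the part [q], so an increment of [x] at [n]
    reduces to one at [p]. *)
Lemma balanced_step n : 6 <= n ->
  exists p q, [/\ balanced n p q, balanced n.+1 p.+1 q & 0 < p <= n %/ 2].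
Proof.
move=> n6; have : n %% 4 < 4 by rewrite ltn_mod.
case En: (n %% 4) => [|[|[|[|//]]]] _.
- by exists (n %/ 2), (n %/ 2).-1; split; [split | split |]; lia.
- by exists (n %/ 2).-1, (n %/ 2).+1; split; [split | split |]; lia.
- by exists (n %/ 2).-1, (n %/ 2); split; [split | split |]; lia.
- by exists (n %/ 2), (n %/ 2); split; [split | split |]; lia.
Qed.

Lemma balanced_sym n p q : balanced n p q -> balanced n q p.
Proof. by case=> *; split; lia. Qed.

(** The two pairings add or subtract the differences [a1 - a2] and [b1 - b2]. If [a] and [b] are
    both even, parity selects the pairing; otherwise the one with opposite signs works. *)
Lemma balanced_add a b a1 a2 b1 b2 :
  balanced a a1 a2 -> balanced b b1 b2 ->
  balanced (a + b + 1) (a1 + b1 + 1) (a2 + b2 + 1) \/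
  balanced (a + b + 1) (a1 + b2 + 1) (a2 + b1 + 1).
Proof.
move=> [ha ? ? oa] [hb ? ? ob].
have [/andP[? /andP[? ?]]|h] := boolP [&& a1 + b1 <= a2 + b2 + 2,
    a2 + b2 <= a1 + b1 + 2 & odd (a + b + 1) ==> odd (a1 + b1 + 1)].
  by left; split; lia.
by right; split; lia.
Qed.

Section BalancedRecurrence.
Variable x : nat -> nat.
Hypothesis hx : x_spec x.

(** A balanced split is unique up to order. The initial values at 3 and 4 fit the recurrence as
    well, whereas at 5 it would give 6. *)
Lemma x_balanced n p q : 3 <= n -> n != 5 -> balanced n p q ->
  x n = (n - 1) + (x p + x q).
Proof.
have [[x1 x2 x3 x4 x5] xE] := hx.
wlog le_qp : p q / q <= p.
  move=> H n3 n5 B; have [le_qp|/ltnW le_pq] := leqP q p; first exact: H.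
  by rewrite [x p + _]addnC; apply: H => //; apply: balanced_sym.
move=> n3 n5 [En ? ? op].
have [n6|n6] := leqP 6 n; last first.
  have [[-> -> ->]|[-> -> ->]] :
      [/\ n = 3, p = 1 & q = 1] \/ [/\ n = 4, p = 2 & q = 1].
  - have [E|E] : n = 3 \/ n = 4 by lia.
    + by left; split; lia.
    + by right; split; lia.
  - by rewrite x3 x1.
  - by rewrite x4 x2 x1.
have [x_1 x_3 x_even] := xE n n6.
have [on|en] := boolP (odd n); last first.
  by rewrite x_even //; congr (_ + (x _ + x _)); lia.
have [n1|n3'] : n %% 4 = 1 \/ n %% 4 = 3 by lia.
  by rewrite x_1 //; congr (_ + (x _ + x _)); lia.
by rewrite x_3 // mul2n -addnn; congr (_ + (x _ + x _)); lia.
Qed.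

Lemma x_small n : 1 <= n <= 13 ->
  x n = nth 0 [:: 0; 0; 1; 2; 4; 5; 8; 10; 13; 15; 18; 20; 24; 27] n.
Proof.
have [[x1 x2 x3 x4 x5] _] := hx.
have R n' p q := @x_balanced n' p q.
have x6 : x 6 = 8 by rewrite (R 6 3 2) ?x3 ?x2.
have x7 : x 7 = 10 by rewrite (R 7 3 3) ?x3.
have x8 : x 8 = 13 by rewrite (R 8 4 3) ?x4 ?x3.
have x9 : x 9 = 15 by rewrite (R 9 5 3) ?x5 ?x3.
have x10 : x 10 = 18 by rewrite (R 10 5 4) ?x5 ?x4.
have x11 : x 11 = 20 by rewrite (R 11 5 5) ?x5.
have x12 : x 12 = 24 by rewrite (R 12 6 5) ?x6 ?x5.
have x13 : x 13 = 27 by rewrite (R 13 7 5) ?x7 ?x5.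
by do 14 case: n => [//|n].
Qed.

Lemma x_succ_le n : 0 < n -> 4 * x n.+1 <= 4 * x n + n + 7.
Proof.
have [m] := ubnP n; elim: m n => // m IH n lt_nm n0.
have [n8|n8] := ltnP n 8.
  by rewrite !x_small; last (by lia); last (by lia);
    move: n n8 n0 {lt_nm}; do 8 case=> //.
have [|p [q [B B' hp]]] := @balanced_step n; first by lia.
have {}IH : 4 * x p.+1 <= 4 * x p + p + 7 by apply: IH; lia.
(* The claim becomes [p + 11 <= n + 7], which follows from [p <= n %/ 2] once [8 <= n]. *)
by rewrite (@x_balanced _ _ _ _ _ B) 1?(@x_balanced _ _ _ _ _ B'); lia.
Qed.

(** One better than the inequality for the pair [(1, b)]; it fails for [b = 1] and [b = 2]. *)
Lemma x_add2_le b : 3 <= b -> x (b + 2) <= b + x b.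
Proof.
move=> b3; have [b8|b8] := ltnP b 8.
  by rewrite !x_small; last (by lia); last (by lia);
    move: b b8 b3; do 8 case=> //.
have h0 : 4 * x b.+1 <= 4 * x b + b + 7 by apply: x_succ_le; lia.
have h1 : 4 * x b.+2 <= 4 * x b.+1 + b.+1 + 7 by apply: x_succ_le.
by rewrite addn2; lia.
Qed.

Lemma x_add_le_small a b : 0 < a -> a <= 5 -> 0 < b -> b <= 7 ->
  x (a + b + 1) <= a + b + (x a + x b).
Proof.
move=> a0 a5 b0 b7; rewrite !x_small; try lia.
by move: a b a0 a5 b0 b7; do 6 case=> //; do 8 case=> //.
Qed.

Lemma x_add_le a b : 0 < a -> 0 < b -> x (a + b + 1) <= a + b + (x a + x b).
Proof.
have [m] := ubnP (a + b); elim: m a b => // m IH a b.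
wlog key : a b / (a <= 2) || (a == 5) || (3 <= a) && (3 <= b) && (b != 5).
  move=> H lt_m a0 b0; have [key|Na] := boolP ((a <= 2) || (a == 5) ||
    (3 <= a) && (3 <= b) && (b != 5)); first exact: H.
  by rewrite [a + b]addnC [x a + _]addnC; apply: H => //; lia.
move=> lt_m a0 b0.
have [[x1 x2 _ _ x5] _] := hx.
have x3 : x 3 = 2 by rewrite x_small.
have [/andP[a5 b7]|large] := boolP ((a <= 5) && (b <= 7)).
  exact: x_add_le_small.
have nb5 : b != 5 by lia.
have [a2|a3] := leqP a 2.
  (* Here [8 <= b]. For [a = 2] and [b = 8] the bound is tight: each increment must be rounded down
     separately. *)
  have h0 := x_succ_le b b0; have h1 := x_succ_le b.+1 isT.
  have h2 := x_succ_le b.+2 isT.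
  have [->|->] : a = 1 \/ a = 2 by lia.
    by rewrite x1 (_ : 1 + b + 1 = b.+2); lia.
  by rewrite x2 (_ : 2 + b + 1 = b.+3); lia.
have b3 : 3 <= b by lia.
have [b1 [b2 Bb]] := balanced_ex b b3.
have xb := x_balanced _ _ _ b3 nb5 Bb.
have [Eb ? ? ?] := Bb.
have IH' c d : 0 < c -> 0 < d -> c + d < a + b ->
  x (c + d + 1) <= c + d + (x c + x d) by move=> *; apply: IH => //; lia.
have [a5|na5] := eqVneq a 5.
  (* The part 3 contributes [3 + x 3 = 5 = x 5], so the part 1 must cost nothing extra, as
     [x_add2_le] ensures. *)
  have B5 : balanced a 3 1 by rewrite a5.
  have [B|B] := balanced_add _ _ _ _ _ _ B5 Bb.
    have h1 : x (3 + b1 + 1) <= 3 + b1 + (x 3 + x b1) by apply: IH'; lia.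
    have h2 : x (b2 + 2) <= b2 + x b2 by apply: x_add2_le; lia.
    rewrite (x_balanced _ _ _ _ _ B); try lia.
    by rewrite (_ : 1 + b2 + 1 = b2 + 2) ?a5; lia.
  have h1 : x (3 + b2 + 1) <= 3 + b2 + (x 3 + x b2) by apply: IH'; lia.
  have h2 : x (b1 + 2) <= b1 + x b1 by apply: x_add2_le; lia.
  rewrite (x_balanced _ _ _ _ _ B); try lia.
  by rewrite (_ : 1 + b1 + 1 = b1 + 2) ?a5; lia.
have [a1 [a2 Ba]] := balanced_ex a a3.
have xa := x_balanced _ _ _ a3 na5 Ba.
have [Ea ? ? ?] := Ba.
(* Since [a1 + a2 = a - 1] and [b1 + b2 = b - 1], the two smaller inequalities add up exactly to the
   claim. *)
have [B|B] := balanced_add _ _ _ _ _ _ Ba Bb.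
  have h1 : x (a1 + b1 + 1) <= a1 + b1 + (x a1 + x b1) by apply: IH'; lia.
  have h2 : x (a2 + b2 + 1) <= a2 + b2 + (x a2 + x b2) by apply: IH'; lia.
  by rewrite (x_balanced _ _ _ _ _ B); lia.
have h1 : x (a1 + b2 + 1) <= a1 + b2 + (x a1 + x b2) by apply: IH'; lia.
have h2 : x (a2 + b1 + 1) <= a2 + b1 + (x a2 + x b1) by apply: IH'; lia.
by rewrite (x_balanced _ _ _ _ _ B); lia.
Qed.

End BalancedRecurrence.

Theorem theorem7 (g x : nat -> nat) (hg : g_spec g) (hx : x_spec x) (n : nat)
  (hn : 1 <= n) : g n = x n.
Proof.
have [[g1 g2 g3 g4 g5] gE] := hg; have [[x1 x2 x3 x4 x5] _] := hx.
have [m] := ubnP n; elim: m n hn => // m IH n n0 lt_nm.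
have [n6|n6] := leqP 6 n; last first.
  by move: n n0 n6 {lt_nm}; case=> [|[|[|[|[|[|]]]]]] // *; congruence.
have IHn k : 0 < k -> k < n -> g k = x k by move=> *; apply: IH; lia.
have [s [[[n1 [n2 [p1 p2 E12 ->]]] s_min] ->]] := gE n n6.
have [|p [q B]] := balanced_ex n; first by lia.
have [Epq ? ? ?] := B.
have xn : x n = n - 1 + (x p + x q) by apply: x_balanced hx _ _ _ _ _ B; lia.
(* Minimality gives one direction; [x_add_le] at the minimizing split gives the other. *)
have le_g : g n1 + g n2 <= g p + g q.
  by apply: s_min; exists p, q; split=> //; lia.
have le_x := x_add_le x hx n1 n2 p1 p2.
rewrite (_ : n1 + n2 + 1 = n) in le_x; last by lia.
by move: le_g; rewrite !IHn; lia.
Qed.
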